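(* Let $S$ be a numerical semigroup. Then: (a) $\mathrm{Betti}(S)$ is totally ordered by $\le_S$ (i.e. $S$ is Betti-sorted) if and only if $\mathcal E(S)$ is totally ordered by $\le_S$; (b) $\mathrm{Betti}(S)$ is totally ordered by divisibility in $\mathbb N$ (i.e. $S$ is Betti-divisible) if and only if $\mathcal E(S)$ is totally ordered by divisibility; (c) $S$ has exactly one Betti element if and only if $\mathcal E(S)$ is a singleton.
   Context: A numerical semigroup $S$ is a submonoid of $(\mathbb N,+)$ with finite complement; $A$ denotes its minimal generating set $\{n_1,\dots,n_e\}$. The cyclotomic exponent sequence $(e_j)_{j\ge1}$ is the unique integer sequence with $(1-x)\sum_{s\in S}x^s=\prod_{j\ge1}(1-x^j)^{e_j}$ in $\mathbb Z[[x]]$, and $\mathcal E(S)=\{d\in\mathbb N: d\ge2,\ e_d\neq0,\ d\notin A\}$. Write $a\le_S b$ if $b-a\in S$. With $\varphi:\mathbb N^e\to S$, $\varphi(a)=\sum_i a_in_i$, let $\mathrm Z(s)=\varphi^{-1}(s)$; $\nabla_s$ is the graph on $\mathrm Z(s)$ where distinct $x,y$ are adjacent iff $x\cdot y\ne0$. $s\in S$ is a Betti element if $\nabla_s$ is disconnected; $\mathrm{Betti}(S)$ is the set of Betti elements. *)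

(* Defs.v *)
From mathcomp Require Import all_boot all_order all_algebra.
From Stdlib Require Import Relations.

Set Implicit Arguments.
Unset Strict Implicit.
Unset Printing Implicit Defensive.

Import GRing.Theory Num.Theory.

Definition numerical_semigroup (S : nat -> bool) : Prop :=
  [/\ S 0,
      (forall a b, S a -> S b -> S (a + b))
    & exists N, forall m, N <= m -> S m].

Definition gen_by (P : nat -> Prop) (s : nat) : Prop :=
  exists l : seq nat, (forall a, a \in l -> P a) /\ sumn l = s.

Definition generating_set (S : nat -> bool) (P : nat -> Prop) : Prop :=
  (forall a, P a -> S a) /\ (forall s, S s <-> gen_by P s).

Definition minimal_generating_set (S : nat -> bool) (P : nat -> Prop) : Prop :=
  generating_set S P /\
  (forall Q : nat -> Prop, (forall a, Q a -> P a) -> generating_set S Q ->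
     forall a, P a -> Q a).

(* a <=_S b  iff  b - a \in S (as integers, so in particular a <= b) *)
Definition le_S (S : nat -> bool) (a b : nat) : Prop := a <= b /\ S (b - a).

(* The minimal generators are enumerated as n : 'I_e -> nat. *)

Definition phi (e : nat) (n : 'I_e -> nat) (x : {ffun 'I_e -> nat}) : nat :=
  \sum_(i < e) x i * n i.

Definition Zfact (e : nat) (n : 'I_e -> nat) (s : nat) (x : {ffun 'I_e -> nat}) : Prop :=
  phi n x = s.

Definition dotp (e : nat) (x y : {ffun 'I_e -> nat}) : nat :=
  \sum_(i < e) x i * y i.

Definition nabla_edge (e : nat) (n : 'I_e -> nat) (s : nat)
  (x y : {ffun 'I_e -> nat}) : Prop :=
  [/\ Zfact n s x, Zfact n s y, x <> y & dotp x y <> 0].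

Definition graph_connected (T : Type) (V : T -> Prop) (E : relation T) : Prop :=
  forall x y, V x -> V y -> clos_refl_trans T E x y.

Definition Betti (S : nat -> bool) (e : nat) (n : 'I_e -> nat) (s : nat) : Prop :=
  S s /\ ~ graph_connected (Zfact n s) (nabla_edge n s).

(* Identities in Z[[x]] are expressed through all truncations mod x^(N+1). *)

Local Open Scope ring_scope.

Definition trunc (N : nat) (p : {poly int}) : {poly int} := \poly_(i < N.+1) p`_i.

(* 1 + x^j + x^(2j) + ... , which is (1 - x^j)^(-1) modulo x^(N+1) for j >= 1 *)
Definition geom_ser (N j : nat) : {poly int} := \sum_(k < N.+1) 'X^(j * k).

(* (1 - x^j)^z modulo x^(N+1) (before truncation), z : int *)
Definition cyc_factor (N j : nat) (z : int) : {poly int} :=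
  match z with
  | Posz m => (1 - 'X^j) ^+ m
  | Negz m => geom_ser N j ^+ m.+1
  end.

Definition semigroup_poly (S : nat -> bool) (N : nat) : {poly int} :=
  \sum_(s < N.+1 | S s) 'X^s.

(* (1 - x) sum_{s in S} x^s = prod_{j >= 1} (1 - x^j)^(ex j) in Z[[x]];
   the factors with j > N are 1 modulo x^(N+1). (ex 0 is irrelevant.) *)
Definition cyclotomic_exponents (S : nat -> bool) (ex : nat -> int) : Prop :=
  forall N : nat,
    trunc N ((1 - 'X) * semigroup_poly S N)
    = trunc N (\prod_(1 <= j < N.+1) cyc_factor N j (ex j)).

Local Close Scope ring_scope.

Definition calE (A : nat -> Prop) (ex : nat -> int) (d : nat) : Prop :=
  [/\ 2 <= d, ex d <> 0%R & ~ A d].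

Definition totally_ordered (R : nat -> nat -> Prop) (P : nat -> Prop) : Prop :=
  forall a b, P a -> P b -> R a b \/ R b a.

(* Main.v *)
(* Let J be the set of vectors x of N^e such that phi x has at least two
   factorizations, and Y the set of minimal elements of J; these are the isolated
   vertices of the graphs nabla_s that have at least two vertices. If the Betti
   elements are totally ordered by <=_S, with least element b, then distinct
   elements of Y have disjoint supports, so the generating function of the
   complement of J is
     prod_(y in Y) (1 - X^(phi y)) / prod_i (1 - X^(n_i)).
   The complement of J has one element in each degree s of S with s - b not in
   S, and none in the other degrees, so the same series is
   (1 - X^b) sum_(s in S) X^s. Comparing exponents,
     e_s = [s = 1] - [s is a generator] - [s = b] + #{y in Y | phi y = s}.
   At a Betti element other than b, some factorization is isolated; at b there
   are at least two such. So the Betti elements are exactly E(S). The induction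
   on s runs this comparison degree by degree and only compares elements that
   are both Betti elements and in E(S), so that an order on either set
   suffices. *)
Require Import Defs.
From mathcomp Require Import all_boot all_order all_algebra.
From mathcomp Require Import zify ring.
From Stdlib Require Import Relations Classical.

Set Implicit Arguments.
Unset Strict Implicit.
Unset Printing Implicit Defensive.

Import GRing.Theory Num.Theory.

(** * Congruences modulo powers of X *)

Section Congruence.
Local Open Scope ring_scope.
Implicit Types (p q r : {poly int}) (g : nat -> nat).

Definition eqX (N : nat) p q := forall k, (k <= N)%N -> p`_k = q`_k.

Lemma eqX_refl N p : eqX N p p. Proof. by []. Qed.

Lemma eqX_sym N p q : eqX N p q -> eqX N q p.
Proof. by move=> h k kN; rewrite h. Qed.

Lemma eqX_trans N p q r : eqX N p q -> eqX N q r -> eqX N p r.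
Proof. by move=> h1 h2 k kN; rewrite h1 ?h2. Qed.

Lemma eqXM N p q p' q' : eqX N p q -> eqX N p' q' -> eqX N (p * p') (q * q').
Proof.
move=> h h' k kN; rewrite !coefM; apply: eq_bigr => i _.
by rewrite h ?h' // (leq_trans _ kN) ?leq_subr // -ltnS.
Qed.

Lemma eqX_prod N (I : Type) (r : seq I) (P : pred I) (F G : I -> {poly int}) :
  (forall i, P i -> eqX N (F i) (G i)) ->
  eqX N (\prod_(i <- r | P i) F i) (\prod_(i <- r | P i) G i).
Proof. by move=> h; apply: big_ind2 => // *; apply: eqXM. Qed.

(** Coefficient [k] of [p * r] is [p_k] plus terms in the lower coefficients of [p], so equality
    propagates upwards from degree 0. *)
Lemma eqX_cancel N p q r : r`_0 = 1 -> eqX N (p * r) (q * r) -> eqX N p q.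
Proof.
move=> r0 h k; elim/ltn_ind: k => k IH kN.
have := h k kN; rewrite !coefM !big_ord_recr /= subnn r0 !mulr1.
rewrite (eq_bigr (fun i : 'I_k => q`_i * r`_(k - i))) => [/addrI //|i _].
by rewrite IH // ltnW // (leq_trans (ltn_ord i)).
Qed.

Lemma eqX_trunc N p q : trunc N p = trunc N q -> eqX N p q.
Proof.
move=> h k kN; have /(congr1 (fun p => p`_k)) := h.
by rewrite !coef_poly ltnS kN.
Qed.

Lemma coefM1subXn p d k :
  (p * (1 - 'X^d))`_k = p`_k - (if (d <= k)%N then p`_(k - d) else 0).
Proof. by rewrite mulrBr mulr1 coefB coefMXn ltnNge; case: leqP. Qed.

Lemma one_subXn_eqX N d : (N < d)%N -> eqX N (1 - 'X^d) 1.
Proof.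
move=> Nd k kN; rewrite coefB coefXn.
by rewrite (ltn_eqF (leq_ltn_trans kN Nd)) subr0.
Qed.

(** Every further term of the expansion has degree at least [2 * N], beyond [N] because [N] is
    positive. *)
Lemma one_subXn_expr N m : (0 < N)%N ->
  eqX N ((1 - 'X^N) ^+ m) (1 - m%:R *: 'X^N).
Proof.
move=> N0; elim: m => [|m IH]; first by rewrite scale0r subr0.
rewrite exprSr; apply: eqX_trans (eqXM IH (@eqX_refl _ _)) _ => k kN.
rewrite coefM1subXn !coefB !coef1 !coefZ !coefXn.
case: (ltngtP k N) kN => [kN|//|->] _; first by rewrite !mulr0n !mulr0 !subr0.
rewrite subnn (gtn_eqF N0) eqxx (ltn_eqF N0) !mulr0n !mulr0 !subr0 mulr1n !mulr1.
by rewrite -addn1 natrD opprD addrA.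
Qed.

(** Exponents are naturals: negative ones are moved to the other side of an identity, so that
    everything stays polynomial. *)
Definition cycprod (N : nat) g : {poly int} :=
  \prod_(1 <= j < N.+1) (1 - 'X^j) ^+ g j.

Lemma cycprodD N g h :
  cycprod N (fun j => g j + h j)%N = cycprod N g * cycprod N h.
Proof. by rewrite -big_split; apply: eq_bigr => j _; rewrite exprD. Qed.

Lemma cycprod0 N g :
  (forall j, (0 < j <= N)%N -> g j = 0%N) -> cycprod N g = 1.
Proof.
by move=> h; rewrite /cycprod big_nat_cond big1 // => j /andP[/h -> _].
Qed.

Lemma cycprod_coef0 N g : (cycprod N g)`_0 = 1.
Proof.
rewrite /cycprod big_nat_cond.
apply: (big_ind (fun p : {poly int} => p`_0 = 1)) => [|p q hp hq|j].
- by rewrite coef1.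
- by rewrite coefM big_ord1 hp hq mulr1.
rewrite andbT => /andP[j0 _]; elim: (g j) => [|m IH]; first by rewrite coef1.
by rewrite exprSr coefM1subXn leqn0 (gtn_eqF j0) IH subr0.
Qed.

Lemma cycprod1 N d : (0 < d <= N)%N ->
  cycprod N (fun j => (j == d) : nat) = 1 - 'X^d.
Proof.
move=> dN; rewrite /cycprod (bigD1_seq d) ?iota_uniq ?mem_index_iota //=.
by rewrite eqxx expr1 big1 ?mulr1 // => j /negPf ->.
Qed.

Lemma cycprod1_eqX N d : (0 < d)%N ->
  eqX N (cycprod N (fun j => (j == d) : nat)) (1 - 'X^d).
Proof.
move=> d0; case: (leqP d N) => dN; first by rewrite cycprod1 ?d0.
rewrite cycprod0; first exact/eqX_sym/one_subXn_eqX.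
by move=> j /andP[_ jN]; rewrite (ltn_eqF (leq_ltn_trans jN dN)).
Qed.

Lemma cycprod_count N (T : Type) (f : T -> nat) (l : seq T) :
  all (fun y => 0 < f y <= N)%N l ->
  \prod_(y <- l) (1 - 'X^(f y)) =
    cycprod N (fun j => count (fun y => f y == j) l).
Proof.
elim: l => [|y l IH] /=; first by rewrite big_nil cycprod0.
move=> /andP[hy hl]; rewrite big_cons IH // cycprodD -(cycprod1 hy).
by congr (_ * _); apply: eq_bigr => j _; rewrite eq_sym.
Qed.

(** Comparison of exponents in a single degree. The factors of index below [s] agree and cancel;
    each side is then a series with constant term 1 times a power of [1 - X^s], and this power
    lowers coefficient [s] by its exponent. *)
Lemma cycprod_step s (F U : {poly int}) g h :
  (0 < s)%N -> F`_0 = 1 -> U`_0 = 1 ->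
  (forall j, (0 < j < s)%N -> g j = h j) ->
  eqX s (F * cycprod s g) (U * cycprod s h) ->
  F`_s - (g s)%:R = U`_s - (h s)%:R.
Proof.
case: s => // s _ F0 U0 gh; rewrite /cycprod ![\prod_(1 <= j < s.+2) _]big_nat_recr //=.
have -> : \prod_(1 <= j < s.+1) (1 - 'X^j : {poly int}) ^+ g j = cycprod s h.
  by apply: eq_big_nat => j /gh ->.
rewrite ![cycprod s h * _]mulrC !mulrA.
move=> /(eqX_cancel (cycprod_coef0 _ _)) e.
have c (p : {poly int}) (m : nat) : p`_0 = 1 ->
    (p * (1 - 'X^(s.+1)) ^+ m)`_s.+1 = p`_s.+1 - m%:R.
  move=> p0; rewrite (eqXM (@eqX_refl s.+1 p) (@one_subXn_expr s.+1 m isT)) //.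
  by rewrite mulrBr mulr1 coefB -scalerAr coefZ coefMXn ltnn subnn p0 mulr1.
by rewrite -!c // e.
Qed.

Definition posexp (z : int) : nat := if z is Posz m then m else 0%N.
Definition negexp (z : int) : nat := if z is Negz m then m.+1 else 0%N.

Lemma pos_negexp z : z + (negexp z)%:R = (posexp z)%:R.
Proof. by case: z => m; rewrite /= ?addr0 ?natz // NegzE; lia. Qed.

Lemma geom_serK N j : (0 < j)%N -> eqX N (geom_ser N j * (1 - 'X^j)) 1.
Proof.
move=> j0.
(* The sum telescopes, and the only power of X left beside 1 has degree above [N]. *)
have -> : geom_ser N j * (1 - 'X^j) = 1 - 'X^(j * N.+1).
  rewrite /geom_ser -[LHS]opprK -mulrN opprB mulrC.
  rewrite (eq_bigr (fun k : 'I_N.+1 => 'X^j ^+ k)) => [|k _]; last by rewrite exprM.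
  by rewrite -subrX1 exprM opprB.
by apply: one_subXn_eqX; rewrite leq_pmull.
Qed.

Lemma cyc_factorK N j z : (0 < j)%N ->
  eqX N (cyc_factor N j z * (1 - 'X^j) ^+ negexp z) ((1 - 'X^j) ^+ posexp z).
Proof.
move=> j0; case: z => m; rewrite /= ?expr0 ?mulr1 // -exprMn.
elim: m.+1 => [|k IH]; first exact: eqX_refl.
by rewrite exprS; have := eqXM (@geom_serK N j j0) IH; rewrite mulr1.
Qed.

(** Clears the geometric series from the identity that defines the exponents, leaving natural powers
    on both sides. *)
Lemma cyc_factor_prodK N (ex : nat -> int) :
  eqX N (\prod_(1 <= j < N.+1) cyc_factor N j (ex j)
           * cycprod N (fun j => negexp (ex j)))
        (cycprod N (fun j => posexp (ex j))).
Proof.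
rewrite /cycprod -big_split /= big_nat_cond [X in eqX _ _ X]big_nat_cond.
by apply: eqX_prod => j; rewrite andbT => /andP[j0 _]; apply: cyc_factorK.
Qed.

Lemma coef_semigroup_poly S N t : (t <= N)%N ->
  (semigroup_poly S N)`_t = (S t : nat)%:R.
Proof.
move=> tN; rewrite coef_sum (eq_bigr (fun i : 'I_N.+1 => (t == i)%:R)); last first.
  by move=> i _; rewrite coefXn.
have tN' : (t < N.+1)%N by [].
rewrite (eq_bigr (fun i : 'I_N.+1 => (Ordinal tN' == i)%:R)) //.
case: (boolP (S t)) => St.
  rewrite (bigD1 (Ordinal tN')) //= eqxx big1 ?addr0 // => i /andP[_ /negPf].
  by rewrite eq_sym => ->.
rewrite big1 // => i Si; case: eqP => // e; move: Si St.
by rewrite -e /= => ->.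
Qed.

End Congruence.

(** * Factorizations *)

Lemma pairwise_on_uniq (T : eqType) (r : rel T) (l : seq T) :
  uniq l -> (forall a b, a \in l -> b \in l -> a <> b -> r a b) -> pairwise r l.
Proof.
elim: l => //= a l IH /andP[al ul] h; rewrite IH // ?andbT => [|b c hb hc]; last first.
  by apply: h; rewrite inE ?hb ?hc orbT.
by apply/allP => b bl; apply: h; rewrite ?inE ?eqxx ?bl ?orbT // => ab; move: al; rewrite ab bl.
Qed.

Section Factorizations.

Variables (e : nat) (n : 'I_e -> nat).
Hypothesis n_gt0 : forall i, 0 < n i.

Notation V := {ffun 'I_e -> nat}.
Implicit Types (x y z w : V) (Y : seq V).

Definition vadd x y : V := [ffun i => x i + y i].
Definition vsub x y : V := [ffun i => x i - y i].
Definition vle x y := [forall i, x i <= y i].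
Definition vunit (i : 'I_e) : V := [ffun j => (j == i) : nat].

Lemma vleP x y : reflect (forall i, x i <= y i) (vle x y).
Proof. exact: forallP. Qed.

Lemma vle_trans x y z : vle x y -> vle y z -> vle x z.
Proof. by move=> /vleP h /vleP k; apply/vleP => i; apply: leq_trans (k i). Qed.

Lemma vle_addr x y : vle x (vadd x y).
Proof. by apply/vleP => i; rewrite ffunE leq_addr. Qed.

Lemma vsubK x y : vle y x -> vadd y (vsub x y) = x.
Proof. by move=> /vleP h; apply/ffunP => i; rewrite !ffunE subnKC. Qed.

Lemma vaddI x : injective (vadd x).
Proof. by move=> y z /ffunP h; apply/ffunP => i; have := h i; rewrite !ffunE => /addnI. Qed.

Lemma vaddC x y : vadd x y = vadd y x.
Proof. by apply/ffunP => i; rewrite !ffunE addnC. Qed.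

Lemma phiD x y : phi n (vadd x y) = phi n x + phi n y.
Proof. by rewrite -big_split; apply: eq_bigr => i _; rewrite ffunE mulnDl. Qed.

Lemma phiB x y : vle y x -> phi n (vsub x y) = phi n x - phi n y.
Proof. by move=> /vsubK h; rewrite -[in RHS]h phiD addKn. Qed.

Lemma vle_phi x y : vle x y -> phi n x <= phi n y.
Proof. by move=> /vsubK <-; rewrite phiD leq_addr. Qed.

Lemma leq_phi x i : x i * n i <= phi n x.
Proof. by rewrite /phi (bigD1 i) //= leq_addr. Qed.

Lemma phi_eq0 x : phi n x = 0 -> forall i, x i = 0.
Proof.
move=> h i; have := leq_phi x i.
by rewrite h leqn0 muln_eq0 (gtn_eqF (n_gt0 i)) orbF => /eqP.
Qed.

Lemma phi_gt0 x : 0 < phi n x -> exists i, 0 < x i.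
Proof.
move=> h; apply/existsP; apply: contraLR h; rewrite negb_exists -leqNgt => /forallP h.
by rewrite /phi big1 // => i _; move: (h i); rewrite -leqNgt leqn0 => /eqP ->.
Qed.

Lemma vle_phi_eq x y : vle x y -> phi n x = phi n y -> x = y.
Proof.
move=> xy p; have /phi_eq0 h : phi n (vsub y x) = 0 by rewrite phiB // p subnn.
apply/ffunP => i; apply/eqP; rewrite eqn_leq (vleP _ _ xy) -subn_eq0.
by have := h i; rewrite ffunE => ->.
Qed.

Lemma phi_vunit i : phi n (vunit i) = n i.
Proof.
rewrite /phi (bigD1 i) //= ffunE eqxx mul1n big1 ?addn0 // => j /negPf ji.
by rewrite ffunE ji.
Qed.

Lemma vle_vunit i x : vle (vunit i) x = (0 < x i).
Proof.
apply/vleP/idP => [/(_ i)|xi j]; rewrite ffunE ?eqxx //.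
by case: eqP => // ->.
Qed.

Lemma dotp_eq0P x y : reflect (forall i, 0 < x i -> 0 < y i -> False) (dotp x y == 0).
Proof.
rewrite /dotp sum_nat_eq0; apply: (iffP forallP) => h i; have := h i.
  by rewrite muln_eq0 => /orP[] /eqP->.
by rewrite muln_eq0; case: (x i) (y i) => // a [|b] // /(_ isT isT).
Qed.

Lemma dotpC x y : dotp x y = dotp y x.
Proof. by apply: eq_bigr => i _; rewrite mulnC. Qed.

(** Since the generators are positive, the coordinates of a factorization of [t] are at most [t], so
    maps into ['I_t.+1] reach them all. *)
Definition facts (t : nat) : seq V :=
  [seq x <- [seq [ffun i => val (f i)] | f : {ffun 'I_e -> 'I_t.+1}] | phi n x == t].

Lemma mem_facts t x : (x \in facts t) = (phi n x == t).
Proof.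
rewrite mem_filter; case: eqP => //= p; apply/mapP.
exists [ffun i => inord (x i)]; first by rewrite mem_enum.
apply/ffunP => i; rewrite !ffunE inordK // ltnS -p.
by apply: leq_trans (leq_phi x i); apply: leq_pmulr.
Qed.

Lemma facts_uniq t : uniq (facts t).
Proof.
rewrite filter_uniq // map_inj_uniq ?enum_uniq // => f g /ffunP h.
by apply/ffunP => i; have := h i; rewrite !ffunE => /val_inj.
Qed.

Lemma size_facts_gt1P t :
  reflect (exists x y, [/\ phi n x = t, phi n y = t & x <> y]) (1 < size (facts t)).
Proof.
apply: (iffP idP) => [h|[x [y [/eqP hx /eqP hy xy]]]].
  have := facts_uniq t; have hm := mem_facts t; case: (facts t) h hm => [|x [|y l]] // _ hm.
  rewrite /= inE negb_or => /andP[/andP[/eqP xy _] _]; exists x, y; split=> //; apply/eqP.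
    by rewrite -hm inE eqxx.
  by rewrite -hm !inE eqxx orbT.
have : size [:: x; y] <= size (facts t).
  apply: uniq_leq_size; first by rewrite /= inE andbT; apply/eqP.
  by move=> z; rewrite !inE mem_facts => /orP[] /eqP ->.
by [].
Qed.

Lemma size_facts_gt1_other t x :
  1 < size (facts t) -> exists2 y, phi n y = t & y <> x.
Proof.
move=> /size_facts_gt1P[y [z [py pz yz]]]; case: (eqVneq y x) => [<-|/eqP]; last by exists y.
by exists z => // /esym.
Qed.

Lemma facts_gt1D x y : 1 < size (facts (phi n x)) -> 1 < size (facts (phi n (vadd x y))).
Proof.
move=> /(@size_facts_gt1_other _ x)[z pz zx]; apply/size_facts_gt1P.
exists (vadd x y), (vadd z y); split; rewrite ?phiD ?pz // => h; apply: zx.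
by apply: (@vaddI y); rewrite ![vadd y _]vaddC.
Qed.

Lemma facts_gt1_le x y : vle x y -> 1 < size (facts (phi n x)) -> 1 < size (facts (phi n y)).
Proof. by move=> /vsubK <-; apply: facts_gt1D. Qed.

Lemma facts_gt1_gt0 t : 1 < size (facts t) -> 0 < t.
Proof.
case: t => // /size_facts_gt1P[x [y [/phi_eq0 hx /phi_eq0 hy []]]].
by apply/ffunP => i; rewrite hx hy.
Qed.

(* The isolated vertices of the graphs of the degrees with several
   factorizations; [isolated_min] and [isolated_exists] identify them with the
   minimal elements of the ideal of vectors of such degree. *)
Definition isolated y :=
  (1 < size (facts (phi n y))) &&
  all (fun z => (z == y) || (dotp z y == 0)) (facts (phi n y)).

Lemma isolated_eq y z i :
  isolated y -> phi n z = phi n y -> 0 < z i -> 0 < y i -> z = y.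
Proof.
move=> /andP[_ /allP h] p zi yi; have := h z; rewrite mem_facts p eqxx => /(_ isT).
by case/orP => [/eqP //|/dotp_eq0P /(_ i zi yi)].
Qed.

(** If [x] were strictly below [y], another factorization [z] of [phi x] would make [z + (y - x)] a
    factorization of [phi y] sharing a coordinate with [y]. Isolation gives [z + (y - x) = y], hence
    [z = x]. *)
Lemma isolated_min x y :
  isolated y -> vle x y -> 1 < size (facts (phi n x)) -> x = y.
Proof.
move=> hy xy /(@size_facts_gt1_other _ x)[z pz zx].
apply: vle_phi_eq => //; apply/eqP; rewrite eqn_leq vle_phi //= leqNgt; apply/negP => lt.
have [i hi] : exists i, 0 < vsub y x i by apply: phi_gt0; rewrite phiB // subn_gt0.
case: zx; apply: (@vaddI (vsub y x)); rewrite [RHS]vaddC vsubK //.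
apply: (isolated_eq hy (i := i)); rewrite ?phiD ?phiB ?pz ?subnK ?vle_phi //.
  by rewrite ffunE ltn_addr.
by move: hi; rewrite ffunE subn_gt0; apply: leq_trans.
Qed.

(** Descent on the degree: if [x] shares coordinate [i] with another factorization [z], removing one
    unit at [i] from both leaves two distinct factorizations of a smaller degree. *)
Lemma isolated_exists x :
  1 < size (facts (phi n x)) -> exists2 y, isolated y & vle y x.
Proof.
have [m] := ubnP (phi n x); elim: m x => // m IH x lt h.
case: (boolP (isolated x)) => [hx|]; first by exists x => //; apply/vleP.
rewrite /isolated h /= => /allPn[z]; rewrite mem_facts => /eqP pz.
rewrite negb_or => /andP[/eqP zx /eqP d].
have [i zi xi] : exists2 i, 0 < z i & 0 < x i.
  apply: NNPP => hn; apply: d; apply/eqP/dotp_eq0P => i zi xi.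
  by apply: hn; exists i.
have zu : vle (vunit i) z by rewrite vle_vunit.
have xu : vle (vunit i) x by rewrite vle_vunit.
have [||y hy yx] := IH (vsub x (vunit i)).
- rewrite phiB // phi_vunit; have := n_gt0 i; have := vle_phi xu; rewrite phi_vunit; lia.
- apply/size_facts_gt1P; exists (vsub x (vunit i)), (vsub z (vunit i)).
  split; rewrite ?phiB ?pz // => e1; apply: zx.
  by rewrite -(vsubK zu) -(vsubK xu) e1.
exists y => //; apply: vle_trans yx _; apply/vleP => j; rewrite ffunE; exact: leq_subr.
Qed.

(** Write [phi z - phi y] as [phi w]. If [y] and [z] met, [y + w] would be a factorization of
    [phi z] meeting [z], hence [z] itself; then [y] lies below [z], against the minimality of
    [z]. *)
Lemma isolated_disjoint (S : nat -> bool) y z :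
  (forall s, S s -> exists x, phi n x = s) ->
  isolated y -> isolated z -> y <> z -> le_S S (phi n y) (phi n z) -> dotp y z = 0.
Proof.
move=> hS hy hz yz [le /hS [w pw]]; apply/eqP/dotp_eq0P => i yi zi; apply: yz.
have e1 : vadd y w = z.
  apply: (isolated_eq hz (i := i)) => //; first by rewrite phiD pw subnKC.
  by rewrite ffunE ltn_addr.
apply: isolated_min => //; first by rewrite -e1 vle_addr.
by case/andP: hy.
Qed.

(** * Vectors avoiding an ideal of N^e, and their generating function *)

Definition avoid Y x := ~~ has (fun y => vle y x) Y.

(** The Hilbert function, for the grading [phi], of the complement of the ideal generated by [Y]. *)
Definition navoid Y (t : nat) : nat := count (avoid Y) (facts t).

(** Among the vectors avoiding [Y], those above [y] are the [y + w] with [w] avoiding [Y]: adding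
    [y] does not affect the coordinates in the support of any element of [Y]. *)
Lemma navoid_cons y Y t : all (fun z => dotp y z == 0) Y ->
  navoid (y :: Y) t + (if phi n y <= t then navoid Y (t - phi n y) else 0) = navoid Y t.
Proof.
move=> /allP hY; rewrite /navoid.
have -> : count (avoid Y) (facts t) =
    count (predI (predC (vle y)) (avoid Y)) (facts t)
      + count (predI (vle y) (avoid Y)) (facts t).
  by rewrite -!(count_filter _ (avoid Y)) addnC count_predC size_filter.
congr (_ + _); first by apply: eq_count => x; rewrite /avoid /= negb_or.
case: leqP => pt; last first.
  apply/esym/eqP; rewrite -leqn0 leqNgt -has_count; apply/hasPn => x.
  rewrite mem_facts /= => /eqP px; apply/negP => /andP[/vle_phi].
  by rewrite px leqNgt pt.
have avoidD x : avoid Y (vadd y x) = avoid Y x.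
  congr (~~ _); apply: eq_in_has => z /hY /dotp_eq0P d.
  apply/vleP/vleP => h i; have := h i; rewrite !ffunE; last lia.
  by case: (posnP (z i)) => [-> //|zi]; have := d i; case: (y i) => // k /(_ isT zi).
rewrite -!size_filter -(size_map (vadd y)); apply/perm_size/uniq_perm.
- rewrite map_inj_uniq; first exact/filter_uniq/facts_uniq.
  by move=> a b; apply: vaddI.
- exact/filter_uniq/facts_uniq.
move=> x; apply/mapP/idP => [[w]|]; rewrite mem_filter mem_facts.
  rewrite mem_filter; move=> /andP[aw /eqP pw] ->.
  by rewrite mem_facts phiD pw subnKC // eqxx /= avoidD aw vle_addr.
move=> /andP[/= /andP[yx ax] /eqP px]; exists (vsub x y); rewrite ?vsubK //.
by rewrite mem_filter mem_facts phiB // px eqxx -avoidD vsubK // ax.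
Qed.

Lemma navoid0 Y : all (fun y => 0 < phi n y) Y -> navoid Y 0 = 1.
Proof.
move=> /allP hY; have phi0 : phi n [ffun=> 0] = 0.
  by rewrite /phi big1 // => i _; rewrite ffunE.
rewrite /navoid; have /permP -> : perm_eq (facts 0) [:: [ffun=> 0] : V].
  apply: uniq_perm => // [|x]; first exact: facts_uniq.
  rewrite mem_facts inE; apply/eqP/eqP => [/phi_eq0 h|-> //].
  by apply/ffunP => i; rewrite h ffunE.
rewrite /= /avoid; case: hasP => // -[y /hY py /vle_phi].
by rewrite phi0 leqNgt py.
Qed.

Definition avoid_poly N Y : {poly int} := (\poly_(t < N.+1) (navoid Y t)%:R)%R.

Lemma avoid_poly_prod N Y : pairwise (fun y z => dotp y z == 0) Y ->
  eqX N (avoid_poly N Y)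
    (avoid_poly N [::] * \prod_(y <- Y) (1 - 'X^(phi n y)))%R.
Proof.
elim: Y => [|y Y IH]; first by rewrite big_nil mulr1.
rewrite pairwise_cons => /andP[hy /IH {}IH]; rewrite big_cons mulrCA mulrC.
apply: eqX_trans (eqXM IH (@eqX_refl _ _)) => k kN.
rewrite coefM1subXn !coef_poly !ltnS kN (leq_trans (leq_subr _ _)) //.
rewrite -(navoid_cons k hy) natrD; case: leqP => _; last by rewrite addr0 subr0.
by rewrite addrK.
Qed.

Definition ngens (j : nat) : nat := count (fun i => n i == j) (enum 'I_e).

Lemma ngens_gt0P j : reflect (exists i, n i = j) (0 < ngens j).
Proof.
rewrite -has_count; apply: (iffP hasP) => [[i _ /eqP]|[i <-]]; first by exists i.
by exists i; rewrite ?mem_enum.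
Qed.

(** Take the unit vectors for [Y] in [avoid_poly_prod]: in degrees up to [N], only the zero vector
    avoids them. Generators above [N] are dropped because [cycprod] stops at index [N], so [g]
    matches [ngens] only up to there. *)
Lemma avoid_poly_gens N : exists2 g : nat -> nat,
  (forall j, j <= N -> g j = ngens j) &
  eqX N (avoid_poly N [::] * cycprod N g)%R 1%R.
Proof.
set Y := [seq vunit i | i <- enum 'I_e & n i <= N].
exists (fun j => count (fun y => phi n y == j) Y) => [j jN|].
  rewrite /ngens count_map count_filter; apply: eq_count => i /=.
  by rewrite phi_vunit; case: eqP => //= ->.
rewrite -cycprod_count; last first.
  by apply/allP => y /mapP[i]; rewrite mem_filter => /andP[ni _] ->; rewrite phi_vunit n_gt0.
apply/eqX_sym/eqX_trans/avoid_poly_prod => [k kN|]; last first.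
  apply: pairwise_on_uniq.
    rewrite map_inj_uniq; first exact/filter_uniq/enum_uniq.
    by move=> i j /ffunP /(_ i); rewrite !ffunE eqxx; case: eqP.
  move=> _ _ /mapP[i _ ->] /mapP[j _ ->] ij; apply/dotp_eq0P => k.
  by rewrite !ffunE; case: eqP => // ki; case: eqP => // kj; case: ij; rewrite -ki -kj.
rewrite coef1 coef_poly ltnS kN; case: k kN => [|k] kN.
  rewrite navoid0 //; apply/allP => y /mapP[i _ ->]; by rewrite phi_vunit n_gt0.
suff -> : navoid Y k.+1 = 0 by [].
apply/eqP; rewrite -leqn0 leqNgt -has_count; apply/hasPn => x.
rewrite mem_facts => /eqP px; apply/negPn/hasP.
have [i xi] : exists i, 0 < x i by apply: phi_gt0; rewrite px.
exists (vunit i); last by rewrite vle_vunit.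
apply: map_f; rewrite mem_filter mem_enum andbT; apply: leq_trans kN.
by rewrite -px; apply: leq_trans (leq_phi x i); apply: leq_pmull.
Qed.

End Factorizations.

(** * Isolated vectors, degree by degree *)

Section Isolated.

Variables (e : nat) (n : 'I_e -> nat).
Hypothesis n_gt0 : forall i, 0 < n i.

Notation V := {ffun 'I_e -> nat}.
Implicit Types (x y z w : V).

Definition isolated_below (s : nat) : seq V :=
  undup [seq y <- flatten [seq facts n t | t <- iota 0 s] | isolated n y].

Definition niso (t : nat) : nat := count (isolated n) (facts n t).

Lemma mem_isolated_below s y :
  (y \in isolated_below s) = isolated n y && (phi n y < s).
Proof.
rewrite mem_undup mem_filter; congr (_ && _).
apply/flatten_mapP/idP => [[t]|ys].
  by rewrite mem_iota mem_facts // => /andP[_ ts] /eqP ->.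
by exists (phi n y); rewrite ?mem_iota ?mem_facts.
Qed.

Lemma count_isolated_below s t :
  count (fun y => phi n y == t) (isolated_below s) = if t < s then niso t else 0.
Proof.
case: ltnP => ts; last first.
  apply/eqP; rewrite -leqn0 leqNgt -has_count; apply/hasPn => y.
  rewrite mem_isolated_below => /andP[_ ys]; apply/negP => /eqP p.
  by move: ys; rewrite p ltnNge ts.
rewrite /niso -!size_filter; apply/perm_size/uniq_perm.
- exact/filter_uniq/undup_uniq.
- exact/filter_uniq/facts_uniq.
move=> y; rewrite mem_filter [RHS]mem_filter mem_isolated_below mem_facts // andbC.
by case: eqP => [->|]; rewrite ?ts ?andbT ?andbF.
Qed.

(** A unique factorization avoids the ideal, since any vector above an isolated one has a degree
    with several factorizations. When [s] has several, a factorization avoids all isolated vectors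
    of smaller degree exactly when it is itself isolated. *)
Lemma navoid_isolated_below s :
  navoid n (isolated_below s) s = niso s + (size (facts n s) == 1).
Proof.
have [s1|s1] := leqP (size (facts n s)) 1.
  have -> : niso s = 0.
    apply/eqP; rewrite -leqn0 leqNgt -has_count; apply/hasPn => y.
    by rewrite mem_facts // /isolated => /eqP ->; rewrite ltnNge s1.
  rewrite add0n /navoid.
  have -> : count (avoid (isolated_below s)) (facts n s) = size (facts n s).
    apply/eqP; rewrite -all_count; apply/allP => x; rewrite mem_facts // => /eqP px.
    apply/hasPn => y; rewrite mem_isolated_below => /andP[/andP[hy _] _].
    apply/negP => yx; have := facts_gt1_le n_gt0 yx hy.
    by rewrite px ltnNge s1.
  by case: (size _) s1 => [|[]].
rewrite (gtn_eqF s1) addn0; apply: eq_in_count => x; rewrite mem_facts // => /eqP px.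
apply/hasPn/idP => [h|hx y].
  have [|y hy yx] := @isolated_exists _ n n_gt0 x; first by rewrite px.
  have sy : s <= phi n y.
    rewrite leqNgt; apply/negP => ys.
    by have := h y; rewrite mem_isolated_below hy ys yx => /(_ isT).
  rewrite -(vle_phi_eq n_gt0 yx) //.
  by apply/eqP; rewrite eqn_leq vle_phi // px sy.
rewrite mem_isolated_below => /andP[hy ys]; apply/negP => yx.
have xy : y = x by apply: (isolated_min n_gt0 hx yx); case/andP: hy.
by move: ys; rewrite xy px ltnn.
Qed.

Definition exponent_formula (ex : nat -> int) (b t : nat) : Prop :=
  (ex t + Posz (ngens n t) + Posz (t == b) = Posz (t == 1) + Posz (niso t))%R.

(** The comparison of the two generating functions in degree [s], once the formula is known below.
    The terms in [S] and [navoid] stay unevaluated: what they amount to is settled inside the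
    induction that uses this relation. *)
Lemma exponent_step (S : nat -> bool) (ex : nat -> int) b s :
  cyclotomic_exponents S ex -> S 0 -> 0 < b -> 0 < s ->
  pairwise (fun y z => dotp y z == 0) (isolated_below s) ->
  (forall t, 0 < t < s -> exponent_formula ex b t) ->
  (ex s + Posz (ngens n s) + Posz (s == b) + Posz (S s) =
   Posz (s == 1) + Posz (navoid n (isolated_below s) s)
     + Posz ((b <= s) && S (s - b))%N)%R.
Proof.
move=> cyc S0 b0 s0 disj IH; set Y := isolated_below s.
have [g gE hg] := avoid_poly_gens n_gt0 s.
have Ypos y : y \in Y -> 0 < phi n y.
  by rewrite mem_isolated_below => /andP[/andP[hy _] _]; apply: facts_gt1_gt0 hy.
(* Exponents on the two sides of the comparison, with the negative part of [ex] moved across. The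
   count over [Y] is 0 at index [s], as [Y] stops strictly below [s]. *)
pose a1 j : nat := negexp (ex j) + ((j == 1) + count (fun y => phi n y == j) Y).
pose a2 j : nat := posexp (ex j) + ((j == b) + g j).
have key : eqX s (semigroup_poly S s * (1 - 'X^b) * cycprod s a1)%R
                 (avoid_poly n s Y * cycprod s a2)%R.
  rewrite /a1 /a2 !cycprodD.
  have hY := @avoid_poly_prod _ _ n_gt0 s _ disj.
  rewrite (@cycprod_count s) in hY; last first.
    apply/allP => y hy; rewrite Ypos //=.
    by move: hy; rewrite mem_isolated_below => /andP[_ /ltnW].
  have h1 := @cycprod1_eqX s 1 isT; have hb := @cycprod1_eqX s b b0.
  have hc := eqXM (eqX_trans (eqX_trunc (cyc s)) (@eqX_refl _ _))
                  (@eqX_refl s (cycprod s (fun j => negexp (ex j)))).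
  have {}hc := eqX_trans hc (@cyc_factor_prodK s ex).
  set C1 := cycprod s (fun j => (j == 1) : nat) in h1 *.
  set Cb := cycprod s (fun j => (j == b) : nat) in hb *.
  set CY := cycprod s (fun j => count _ Y) in hY *.
  set Cn := cycprod s (fun j => negexp _) in hc *.
  set Cp := cycprod s (fun j => posexp _) in hc *.
  set SP := semigroup_poly S s in hc *; set D := avoid_poly n s [::] in hg hY *.
  (* Both sides reduce to this product: the left because [(1 - X) * SP * Cn] is [Cp], the right
     because [D * cycprod s g] is 1. *)
  apply: (@eqX_trans _ _ (Cp * (1 - 'X^b) * CY)%R).
    have := eqXM (eqXM hc (@eqX_refl s (1 - 'X^b)%R)) (@eqX_refl s CY).
    apply: eqX_trans; apply: (@eqX_trans _ _ (SP * (1 - 'X^b) * (Cn * ((1 - 'X) * CY)))%R).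
      by apply: eqXM => //; apply: eqXM => //; apply: eqXM.
    rewrite (_ : SP * (1 - 'X^b) * _ = (1 - 'X) * SP * Cn * (1 - 'X^b) * CY)%R //.
    ring.
  apply: eqX_sym.
  apply: (@eqX_trans _ _ (D * CY * (Cp * ((1 - 'X^b) * cycprod s g)))%R).
    by apply: eqXM => //; apply: eqXM => //; apply: eqXM.
  have := eqXM (@eqX_refl s (Cp * (1 - 'X^b) * CY)%R) hg.
  rewrite mulr1; apply: eqX_trans.
  rewrite (_ : (D * CY * _ = Cp * (1 - 'X^b) * CY * (D * cycprod s g))%R) //.
  ring.
have U0 : ((avoid_poly n s Y)`_0 = 1)%R.
  by rewrite coef_poly ltn0Sn navoid0 //; apply/allP.
have F0 : ((semigroup_poly S s * (1 - 'X^b))`_0 = 1)%R.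
  by rewrite coefM1subXn leqn0 (gtn_eqF b0) coef_semigroup_poly // S0 subr0.
have gh j : 0 < j < s -> a1 j = a2 j.
  move=> /andP[j0 js]; have := IH j; rewrite j0 js /exponent_formula => /(_ isT).
  rewrite /a1 /a2 count_isolated_below js gE ?(ltnW js) //.
  have := pos_negexp (ex j); rewrite !natz; lia.
have := cycprod_step s0 F0 U0 gh key.
rewrite coefM1subXn coef_poly ltnSn coef_semigroup_poly // /a1 /a2 gE //.
rewrite coef_semigroup_poly ?leq_subr // count_isolated_below ltnn.
have := pos_negexp (ex s); rewrite !natz.
by case: leqP => _ /=; lia.
Qed.

End Isolated.

(** * Betti elements and exponents *)

Section Generators.

Variables (S : nat -> bool) (e : nat) (n : 'I_e -> nat).
Hypothesis n_inj : injective n.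
Let A (a : nat) : Prop := exists i, n i = a.
Hypothesis A_min : minimal_generating_set S A.

Lemma gen_by_add (P : nat -> Prop) a b : gen_by P a -> gen_by P b -> gen_by P (a + b).
Proof.
move=> [l [hl <-]] [k [hk <-]]; exists (l ++ k); rewrite sumn_cat; split=> // c.
by rewrite mem_cat => /orP[/hl|/hk].
Qed.

Lemma gen_by0 (P : nat -> Prop) : gen_by P 0.
Proof. by exists [::]. Qed.

Lemma gen_by1 (P : nat -> Prop) a : P a -> gen_by P a.
Proof. by move=> Pa; exists [:: a]; rewrite /= addn0; split=> // c; rewrite inE => /eqP ->. Qed.

Lemma gen_by_phi (P : nat -> Prop) (x : {ffun 'I_e -> nat}) :
  (forall i, 0 < x i -> gen_by P (n i)) -> gen_by P (phi n x).
Proof.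
move=> h; apply: (big_ind (gen_by P)); [exact: gen_by0|exact: gen_by_add|move=> i _].
have := h i; elim: (x i) => [|k IH] hk; first exact: gen_by0.
rewrite mulSn; have hn := hk isT; apply: gen_by_add => //.
by apply: IH.
Qed.

Lemma gen_by_sub (P Q : nat -> Prop) s :
  (forall a, P a -> gen_by Q a) -> gen_by P s -> gen_by Q s.
Proof.
move=> h [l [hl <-]]; elim: l hl => [|a l IH] hl /=; first exact: gen_by0.
apply: gen_by_add; first by apply/h/hl; rewrite inE eqxx.
by apply: IH => c hc; apply: hl; rewrite inE hc orbT.
Qed.

Lemma semigroupP s : S s <-> exists x, phi n x = s.
Proof.
have [[PS gen] _] := A_min; split=> [/gen [l [hl <-]]|[x <-]]; last first.
  by apply/gen/gen_by_phi => i _; apply: gen_by1; exists i.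
elim: l hl => [|a l IH] hl /=.
  by exists [ffun=> 0]; rewrite /phi big1 // => i _; rewrite ffunE.
have [x <-] : exists x, phi n x = sumn l.
  by apply: IH => c hc; apply: hl; rewrite inE hc orbT.
have [i <-] : A a by apply: hl; rewrite inE eqxx.
by exists (vadd (vunit i) x); rewrite phiD phi_vunit.
Qed.

(** Otherwise the generators other than [a] would still generate [S], and minimality would put [a]
    among them. *)
Lemma irredundant a : A a ->
  (forall Q : nat -> Prop, (forall b, Q b <-> A b /\ b <> a) -> gen_by Q a -> False).
Proof.
have [[PS gen] mini] := A_min; move=> Aa Q hQ genQ.
have QA b : Q b -> A b by case/hQ.
suff /(mini _ QA) /(_ a Aa) /hQ [_] : generating_set S Q by [].
split=> [b /QA /PS //|s]; split=> [/gen|]; last first.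
  by move/(gen_by_sub (fun b Qb => gen_by1 (QA b Qb))) => /gen.
apply: gen_by_sub => b Ab; case: (eqVneq b a) => [-> //|/eqP ba].
by apply/gen_by1/hQ.
Qed.

Lemma generator_gt0 i : 0 < n i.
Proof.
rewrite lt0n; apply/eqP => ni.
apply: (@irredundant (n i) _ (fun b => A b /\ b <> n i)) => //; first by exists i.
by rewrite ni; apply: gen_by0.
Qed.

(** Another factorization of [n i] cannot use [n i], since by degree it would be the unit vector. It
    would then express [n i] through the other generators. *)
Lemma generator_facts i : size (facts n (n i)) <= 1.
Proof.
rewrite leqNgt; apply/negP => /(@size_facts_gt1_other _ _ generator_gt0 _ (vunit i)) [x px xu].
have xi : x i = 0.
  apply/eqP; rewrite -leqn0 leqNgt -vle_vunit; apply/negP => ux; apply: xu.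
  by rewrite (vle_phi_eq generator_gt0 ux) // phi_vunit.
apply: (@irredundant (n i) _ (fun b => A b /\ b <> n i)) => //; first by exists i.
rewrite -{2}px; apply: gen_by_phi => j xj; apply: gen_by1; split; first by exists j.
by move=> /n_inj ji; move: xj; rewrite ji xi.
Qed.

End Generators.

(** * Graphs of factorizations and the induction on degrees *)

Section Main.

Variables (S : nat -> bool) (e : nat) (n : 'I_e -> nat).
Hypothesis n_gt0 : forall i, 0 < n i.
Hypothesis SP : forall s, S s <-> exists x, phi n x = s.

Lemma Betti_facts s : Betti S n s -> 1 < size (facts n s).
Proof.
move=> [_ disc]; rewrite ltnNge; apply/negP => le1; apply: disc => x y px py.
suff -> : x = y by apply: rt_refl.
apply: NNPP => xy; have : 1 < size (facts n s) by apply/size_facts_gt1P => //; exists x, y.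
by rewrite ltnNge le1.
Qed.

(** An isolated vector has no neighbour, so a walk from it never reaches the second
    factorization. *)
Lemma isolated_Betti y : isolated n y -> Betti S n (phi n y).
Proof.
move=> hy; split=> [|conn]; first by apply/SP; exists y.
case/andP: (hy) => /(@size_facts_gt1_other _ _ n_gt0 _ y) [z pz zy] _; apply: zy.
have step a b : clos_refl_trans _ (nabla_edge n (phi n y)) a b -> a = y -> b = y.
  elim=> {a b} [a b [_ pb ab d] ay|//|a b c _ h1 _ h2 /h1 /h2 //].
  case: ab; rewrite ay; apply: NNPP => yb; apply: d; apply/eqP/dotp_eq0P => i ai bi.
  by apply: yb; apply/esym/(isolated_eq n_gt0 hy (i := i)) => //; rewrite -ay.
exact: step (conn y z erefl pz) erefl.
Qed.

Lemma nabla_share s x y i : phi n x = s -> phi n y = s -> 0 < x i -> 0 < y i ->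
  clos_refl_trans _ (nabla_edge n s) x y.
Proof.
move=> px py xi yi; case: (eqVneq x y) => [->|/eqP xy]; first exact: rt_refl.
by apply: rt_step; split=> // /eqP/dotp_eq0P /(_ i xi yi).
Qed.

Lemma isolated_gt0 y : isolated n y -> exists i, 0 < y i.
Proof. by case/andP => h _; apply/(phi_gt0 (n := n))/(facts_gt1_gt0 n_gt0 h). Qed.

(** If no factorization of [s] is isolated, each lies above an isolated vector of smaller degree.
    Such degrees are Betti elements, hence comparable, and this joins any two factorizations through
    a third one. *)
Lemma Betti_isolated s :
  (forall a b, Betti S n a -> Betti S n b -> a < s -> b < s -> le_S S a b \/ le_S S b a) ->
  Betti S n s -> exists2 y, isolated n y & phi n y = s.
Proof.
move=> tot hs; apply: NNPP => none; have s1 := Betti_facts hs; case: hs => _; apply.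
have below x : phi n x = s -> exists y, [/\ isolated n y, vle y x & phi n y < s].
  move=> px; have [|y hy yx] := @isolated_exists _ n n_gt0 x; first by rewrite px.
  exists y; split=> //; rewrite ltn_neqAle -{2}px vle_phi // andbT.
  by apply/eqP => py; apply: none; exists y.
(* For isolated [y <= x] and [z <= t] with [phi z - phi y = phi v], the vector
   [v + y + (t - z)] is a factorization of [s] sharing a coordinate with both
   [x] and [t]. *)
have link x t y z : phi n x = s -> phi n t = s -> isolated n y -> vle y x ->
    vle z t -> phi n z < s -> le_S S (phi n y) (phi n z) ->
    exists2 m, clos_refl_trans _ (nabla_edge n s) x m &
               clos_refl_trans _ (nabla_edge n s) m t.
  move=> px pt hy yx zt zs [yz /SP [v pv]].
  have [i yi] := isolated_gt0 hy.
  have [j wj] : exists j, 0 < vsub t z j by apply: (phi_gt0 (n := n)); rewrite phiB // pt subn_gt0.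
  have xi : 0 < x i by apply: leq_trans yi (vleP _ _ yx i).
  have tj : 0 < t j by move: wj; rewrite ffunE; lia.
  have pm : phi n (vadd (vadd y v) (vsub t z)) = s.
    by rewrite !phiD pv subnKC // phiB // pt subnKC // ltnW.
  exists (vadd (vadd y v) (vsub t z)).
    by apply: (nabla_share (i := i)) => //; rewrite !ffunE; lia.
  apply: (nabla_share (i := j)) => //; rewrite !ffunE; move: wj; rewrite ffunE; lia.
have sym x t : clos_refl_trans _ (nabla_edge n s) x t ->
               clos_refl_trans _ (nabla_edge n s) t x.
  elim=> {x t} [x t [px pt xt d]|x|x u t _ h1 _ h2].
  - by apply: rt_step; split=> // [/esym //|]; rewrite dotpC.
  - exact: rt_refl.
  - exact: rt_trans h2 h1.
move=> x t px pt; have [y [hy yx ys]] := below x px; have [z [hz zt zs]] := below t pt.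
case: (tot _ _ (isolated_Betti hy) (isolated_Betti hz) ys zs) => le.
  by have [m h1 h2] := link x t y z px pt hy yx zt zs le; apply: rt_trans h1 h2.
have [m h1 h2] := link t x z y pt px hz zt yx ys le.
by apply/sym/(rt_trans _ _ _ _ _ h1 h2).
Qed.

Variable ex : nat -> int.
Hypothesis n_unique : forall i, size (facts n (n i)) <= 1.
Hypothesis cyc : cyclotomic_exponents S ex.

Let A (a : nat) : Prop := exists i, n i = a.

(** Below [s] the two sets already agree, so there the order on common elements is an order on Betti
    elements. The bound [N] and the conditional hypothesis on [b] cover the case of no Betti element
    up to [N]. *)
Lemma exponents_Betti N b :
  totally_ordered (le_S S) (fun s => Betti S n s /\ calE A ex s) ->
  0 < b -> (b <= N -> Betti S n b) -> (forall t, t <= N -> Betti S n t -> b <= t) ->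
  forall s, 0 < s <= N ->
    exponent_formula n ex b s /\ (Betti S n s <-> calE A ex s).
Proof.
move=> tot b0 bB bmin; elim/ltn_ind => s IH /andP[s0 sN].
have S0 : S 0 by apply/SP; exists [ffun=> 0]; rewrite /phi big1 // => i _; rewrite ffunE.
have Betti_pos t : Betti S n t -> 0 < t by move=> /Betti_facts; apply: facts_gt1_gt0.
have IH' t : 0 < t < s -> exponent_formula n ex b t /\ (Betti S n t <-> calE A ex t).
  by case/andP=> t0 ts; apply: IH; rewrite ?t0 // ltnW // (leq_trans ts).
have BE t : t < s -> Betti S n t -> calE A ex t.
  by move=> ts ht; have [|_ <-] := IH' t; first by rewrite ts Betti_pos.
have totB a c : Betti S n a -> Betti S n c -> a < s -> c < s -> le_S S a c \/ le_S S c a.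
  by move=> ha hc as_ cs; apply: tot; split=> //; apply: BE.
have disj : pairwise (fun y z => dotp y z == 0) (isolated_below n s).
  apply: pairwise_on_uniq; first exact: undup_uniq.
  move=> y z; rewrite !mem_isolated_below // => /andP[hy ys] /andP[hz zs] yz; apply/eqP.
  have SP' t : S t -> exists x, phi n x = t by move/SP.
  case: (totB _ _ (isolated_Betti hy) (isolated_Betti hz) ys zs) => le.
    exact: isolated_disjoint SP' hy hz yz le.
  by rewrite dotpC; apply: isolated_disjoint SP' hz hy _ le => // /esym.
have := exponent_step n_gt0 cyc S0 b0 s0 disj (fun t h => (IH' t h).1).
rewrite navoid_isolated_below // => step.
have Ss : S s = (0 < size (facts n s)).
  apply/idP/idP => [/SP [x px]|].
    by rewrite lt0n size_eq0; apply/eqP => nil; have := mem_facts n_gt0 s x; rewrite nil px eqxx.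
  case hf : (facts n s) => [//|x l] _; apply/SP; exists x; apply/eqP.
  by rewrite -(mem_facts n_gt0) hf inE eqxx.
have nisoP : reflect (exists2 y, isolated n y & phi n y = s) (0 < niso n s).
  rewrite -has_count; apply: (iffP hasP) => [[y]|[y hy py]].
    by rewrite mem_facts // => /eqP py hy; exists y.
  by exists y => //; rewrite mem_facts ?py.
have nA : 1 < size (facts n s) -> ngens n s = 0.
  move=> s1; apply/eqP; rewrite -leqn0 leqNgt; apply/negP => /ngens_gt0P[i ni].
  by move: s1; rewrite -ni ltnNge n_unique.
(* Each factorization of [s] lies above an isolated vector, whose degree can then only be [s]. *)
have all_isolated : (forall y, isolated n y -> phi n y < s -> ~ le_S S (phi n y) s) ->
    1 < size (facts n s) -> niso n s = size (facts n s).
  move=> low s1; apply/eqP; rewrite -all_count; apply/allP => x; rewrite mem_facts // => /eqP px.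
  have [|y hy yx] := @isolated_exists _ n n_gt0 x; first by rewrite px.
  rewrite -(vle_phi_eq n_gt0 yx) //; have := vle_phi n yx; rewrite px leq_eqVlt => /orP[/eqP //|ys].
  exfalso; apply: (low y) => //; split; first exact: ltnW.
  by apply/SP; exists (vsub x y); rewrite phiB // px.
have Betti_s : 0 < niso n s -> Betti S n s.
  by move=> /nisoP[y hy <-]; apply: isolated_Betti.
(* Several factorizations occur exactly in the degrees above [b] for the order of [S]. The hard
   direction is by contradiction: every factorization of [s] would be isolated, since the order
   below [s] puts [b] under every smaller isolated degree. *)
have facts_b : (1 < size (facts n s)) = (b <= s) && S (s - b).
  apply/idP/idP => [s1|/andP[bs /SP [w pw]]]; last first.
    have := Betti_facts (bB (leq_trans bs sN)) => /[dup] /size_facts_gt1P[//|x [_ [px _ _]]].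
    rewrite -px => /(facts_gt1D n_gt0 w); by rewrite phiD px pw subnKC.
  apply: contraT => nb; exfalso.
  have low y : isolated n y -> phi n y < s -> ~ le_S S (phi n y) s.
    move=> hy ys [_ Sy]; have hB := isolated_Betti hy.
    have by_ : b <= phi n y by apply: bmin hB; apply: leq_trans (ltnW ys) sN.
    have bs := leq_ltn_trans by_ ys.
    have Sb : S (phi n y - b).
      case: (totB _ _ (bB (leq_trans (ltnW bs) sN)) hB bs ys) => [[] //|[yb _]].
      by rewrite (_ : phi n y - b = 0) //; apply/eqP; rewrite subn_eq0.
    move: nb; rewrite (ltnW bs) /=; case/negP.
    have [/SP [u pu] /SP [v pv]] := (Sb, Sy).
    by apply/SP; exists (vadd u v); rewrite phiD pu pv; lia.
  have iso := all_isolated low s1.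
  have hs : Betti S n s by apply: Betti_s; rewrite iso; apply: ltnW.
  have bs : b <= s := bmin _ sN hs.
  have bs' : b < s.
    rewrite ltn_neqAle bs andbT; apply/eqP => bs_; move: nb.
    by rewrite bs_ leqnn subnn S0.
  (* To compare [b] with [s] itself, [s] must be known to lie in both sets. Here [step] gives [ex s]
     at least [size (facts n s) - 1], which is positive. *)
  have hE : calE A ex s.
    split; first by lia.
      move: step; rewrite (nA s1) (negPf nb) iso Ss; lia.
    move=> [i ni]; have := n_unique i; rewrite ni; lia.
  have : le_S S b s \/ le_S S s b.
    have hb := bB (leq_trans bs sN).
    by apply: tot; split=> //; apply: BE.
  case=> [[_ sb]|[]]; last lia.
  by move: nb; rewrite bs sb.
have F : exponent_formula n ex b s.
  by move: step; rewrite /exponent_formula -facts_b Ss; lia.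
split=> //; split=> [hs|[s2 exs nAs]].
  have s1 := Betti_facts hs; have [y hy py] := Betti_isolated totB hs.
  have ni : 0 < niso n s by apply/nisoP; exists y.
  split.
  - rewrite ltn_neqAle s0 andbT; apply/eqP => s_1.
    have [x [_ [px _ _]]] := size_facts_gt1P n_gt0 _ s1.
    have [i xi] : exists i, 0 < x i by apply: (phi_gt0 (n := n)); rewrite px.
    have ni1 : n i = s.
      apply/eqP; rewrite eqn_leq -{2}s_1 n_gt0 andbT -px.
      by apply: leq_trans (leq_phi n x i); apply: leq_pmull.
    by have := n_unique i; rewrite ni1 leqNgt s1.
  - move: F; rewrite /exponent_formula nA //.
    case: (eqVneq s b) => [sb|_]; last lia.
    (* At [b] the term [s == b] costs 1, but nothing isolated lies in a lower degree, so all of the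
       at least two factorizations count. *)
    have -> : niso n s = size (facts n s); last lia.
    apply: all_isolated => // z hz zs; exfalso.
    have := bmin _ (ltnW (leq_trans zs sN)) (isolated_Betti hz); lia.
  - by move=> /ngens_gt0P; rewrite nA.
(* Without isolated factorizations [s] differs from [b], and the formula leaves [ex s = 0] because
   [s] is at least 2 and not a generator. *)
apply: Betti_s; rewrite lt0n; apply/eqP => ni.
have gens0 : ngens n s = 0 by apply/eqP; rewrite -leqn0 leqNgt; apply/negP => /ngens_gt0P.
have bs : s <> b.
  move=> sb; move: (bB); rewrite -sb => /(_ sN) hs.
  have /nisoP : exists2 y, isolated n y & phi n y = s by apply: Betti_isolated.
  by rewrite ni.
by move: F; rewrite /exponent_formula gens0 ni; lia.
Qed.

(** When no Betti element is at most [N], the value [N + 1] serves. *)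
Lemma least_Betti N : exists b,
  [/\ 0 < b, b <= N -> Betti S n b & forall t, t <= N -> Betti S n t -> b <= t].
Proof.
have pos t : Betti S n t -> 0 < t by move/Betti_facts/(facts_gt1_gt0 n_gt0).
elim: N => [|N [b [b0 bB bmin]]].
  by exists 1; split=> // t; rewrite leqn0 => /eqP -> /pos.
have [bN|Nb] := leqP b N.
  exists b; split=> // [_|t]; first exact: bB.
  by rewrite leq_eqVlt => /orP[/eqP -> _|]; [exact: leqW|exact: bmin].
have [hN|hN] := classic (Betti S n N.+1).
  exists N.+1; split=> // t; rewrite leq_eqVlt => /orP[/eqP -> //|tN] ht.
  by apply: leq_trans Nb _; apply: bmin.
exists N.+2; split=> // [|t]; first by rewrite ltnn.
rewrite leq_eqVlt => /orP[/eqP -> //|tN] ht.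
by have := leq_trans Nb (bmin _ tN ht); rewrite ltnNge -ltnS tN.
Qed.

Lemma Betti_calE :
  totally_ordered (le_S S) (fun s => Betti S n s /\ calE A ex s) ->
  forall s, Betti S n s <-> calE A ex s.
Proof.
move=> tot [|s]; first by split=> [/Betti_facts/(facts_gt1_gt0 n_gt0)|[]].
have [b [b0 bB bmin]] := least_Betti s.+1.
by have [] := exponents_Betti tot b0 bB bmin (s := s.+1) (leqnn _).
Qed.

(** If [b = k * a] with [k] positive, then [b - a] is [k - 1] copies of [a]. Positivity of [b]
    excludes [b = 0], which every [a] divides. *)
Lemma dvdn_le_S a b : S a -> 0 < b -> a %| b -> le_S S a b.
Proof.
move=> /SP [x <-] b0 /dvdnP [k bk]; rewrite {}bk in b0 *.
case: k b0 => // k _; rewrite mulSn; split; first exact: leq_addr.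
rewrite addKn; apply/SP; elim: k => [|k [y py]].
  by exists [ffun=> 0]; rewrite /phi big1 // => i _; rewrite ffunE.
by exists (vadd x y); rewrite phiD py mulSn.
Qed.

End Main.

Lemma totally_ordered_iff (R : nat -> nat -> Prop) (P Q : nat -> Prop) :
  (forall s, P s <-> Q s) -> totally_ordered R P <-> totally_ordered R Q.
Proof. by move=> h; split=> tot a b /h ha /h hb; apply: tot. Qed.

Theorem theorem1p3 (S : nat -> bool) (e : nat) (n : 'I_e -> nat) (ex : nat -> int) :
  numerical_semigroup S ->
  injective n ->
  minimal_generating_set S (fun a => exists i, n i = a) ->
  cyclotomic_exponents S ex ->
  [/\ totally_ordered (le_S S) (Betti S n)
        <-> totally_ordered (le_S S) (calE (fun a => exists i, n i = a) ex),
      totally_ordered (fun a b => a %| b) (Betti S n)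
        <-> totally_ordered (fun a b => a %| b) (calE (fun a => exists i, n i = a) ex)
    & (exists b, forall s, Betti S n s <-> s = b)
        <-> (exists d, forall s, calE (fun a => exists i, n i = a) ex s <-> s = d)].
Proof.
move=> semi inj gens cyc; set E := calE _ ex.
have n_gt0 := generator_gt0 gens; have SP := semigroupP gens.
have S0 : S 0 by case: semi.
have main := Betti_calE n_gt0 SP (generator_facts inj gens) cyc; rewrite -/E in main.
(* Common elements are positive members of [S], so divisibility between them is stronger than the
   order of [S]. *)
have dvd : totally_ordered (fun a b => a %| b) (fun s => Betti S n s /\ E s) ->
           totally_ordered (le_S S) (fun s => Betti S n s /\ E s).
  have pos s : Betti S n s -> 0 < s by move/(Betti_facts n_gt0)/(facts_gt1_gt0 n_gt0).
  move=> tot a b ha hb; case: (tot a b ha hb) => d; [left|right].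
    by apply: (dvdn_le_S SP) => //; [exact: ha.1.1|exact: pos hb.1].
  by apply: (dvdn_le_S SP) => //; [exact: hb.1.1|exact: pos ha.1].
have refl a : le_S S a a by rewrite /le_S subnn.
split; split.
- move=> tot; apply/(totally_ordered_iff _ (main _)) => //.
  by move=> a b [ha _] [hb _]; apply: tot.
- move=> tot; apply/(totally_ordered_iff _ (main _)) => //.
  by move=> a b [_ ha] [_ hb]; apply: tot.
- move=> tot; apply/(totally_ordered_iff _ (main (dvd _))) => //.
  by move=> a b [ha _] [hb _]; apply: tot.
- move=> tot; apply/(totally_ordered_iff _ (main (dvd _))) => //.
  by move=> a b [_ ha] [_ hb]; apply: tot.
(* If one of the sets is a singleton, the common elements are trivially ordered, so the sets
   coincide. *)
- move=> [b hb]; exists b => s; rewrite -hb; apply: iff_sym; apply: main.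
  by move=> u v [/hb -> _] [/hb -> _]; left.
move=> [d hd]; exists d => s; rewrite -hd; apply: main.
by move=> u v [_ /hd ->] [_ /hd ->]; left.
Qed.
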